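(* Let $k$ be a field. The assignment sending a graph $E$ to its path algebra $kE$ and sending a morphism $f$ from $E$ to $F$ in $IPG$ to the linear map $f_*\colon kE\to kF$ determined by $$f_*(\chi_p)=\chi_{f(p)}\quad\text{for all }p\in FP(E),$$ defines a covariant functor from $IPG$ to the category $KA$ of $k$-algebras and algebra homomorphisms. Furthermore, the same assignment restricted to the subcategory $BPG$ yields a covariant functor to the category $UKA$ of unital $k$-algebras and unital algebra homomorphisms.
   Context: A graph $E=(E^0,E^1,s_E,t_E)$ consists of a set $E^0$ of vertices, a set $E^1$ of edges, and source and target maps $s_E,t_E\colon E^1\to E^0$. A finite path is a vertex (length $0$) or a finite sequence $e_1\ldots e_n$ ($n\ge1$) of edges with $t_E(e_i)=s_E(e_{i+1})$. $FP(E)$ is the set of finite paths; $s_{PE},t_{PE}\colon FP(E)\to E^0$ are the beginning and end maps (a vertex begins and ends at itself). A path homomorphism from $E$ to $F$ is a map $f\colon FP(E)\to FP(F)$ with $f(E^0)\subseteq F^0$, $s_{PF}\circ f=f\circ s_{PE}$, $t_{PF}\circ f=f\circ t_{PE}$, and $f(pq)=f(p)f(q)$ whenever $t_{PE}(p)=s_{PE}(q)$. $IPG$ is the category of graphs and path homomorphisms that are injective on vertices. $BPG$ is its subcategory whose objects are graphs with finitely many vertices and whose morphisms are the path homomorphisms that are bijective on vertices. The path algebra $kE$ is the $k$-vector space with basis $\{\chi_p\}_{p\in FP(E)}$ and multiplication $\chi_p\chi_q=\chi_{pq}$ if $t_{PE}(p)=s_{PE}(q)$ and $0$ otherwise ($kE=0$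 if $E=\emptyset$). *)

(* Defs.v *)
From HB Require Import structures.
From mathcomp Require Import all_boot all_algebra finmap.
From mathcomp Require Import boolp classical_sets cardinality.
From mathcomp.multinomials Require Import monalg.

Set Implicit Arguments.
Unset Strict Implicit.
Unset Printing Implicit Defensive.

Import GRing.Theory.

Local Open Scope ring_scope.

Record graph := Graph {
  vertex : Type;
  edge : Type;
  source : edge -> vertex;
  target : edge -> vertex }.

Section FinitePaths.
Variable E : graph.

Fixpoint chained (e : edge E) (s : seq (edge E)) : Prop :=
  if s is e' :: s' then target e = source e' /\ chained e' s' else True.

(* [EPath e s _] is the path of positive length with edge sequence [e :: s]. *)
Inductive finite_path :=
  | VPath of vertex E
  | EPath (e : edge E) (s : seq (edge E)) of chained e s.

Definition psource (p : finite_path) : vertex E :=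
  match p with VPath v => v | @EPath e _ _ => source e end.

Definition ptarget (p : finite_path) : vertex E :=
  match p with VPath v => v | @EPath e s _ => target (last e s) end.

Lemma chained_cat e s e' s' : chained e s -> chained e' s' ->
  target (last e s) = source e' -> chained e (s ++ e' :: s').
Proof.
elim: s e => [|e1 s IHs] e /=; first by move=> _ ? ?.
by move=> [-> c] c' h; split=> //; exact: IHs.
Qed.

Definition pcat (p q : finite_path) : ptarget p = psource q -> finite_path :=
  match p with
  | VPath _ => fun=> q
  | @EPath e s c =>
    match q with
    | VPath _ => fun=> EPath c
    | @EPath e' s' c' => fun h => EPath (chained_cat c c' h)
    end
  end.

Lemma EPath_eq e s s' (c : chained e s) (c' : chained e s') :
  s = s' -> EPath c = EPath c'.
Proof. by move=> ss; subst s'; rewrite (Prop_irrelevance c c'). Qed.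

Lemma psource_cat p q (h : ptarget p = psource q) :
  psource (pcat h) = psource p.
Proof. by case: p q h => [v|e s c] [w|e' s' c'] h. Qed.

Lemma ptarget_cat p q (h : ptarget p = psource q) :
  ptarget (pcat h) = ptarget q.
Proof. by case: p q h => [v|e s c] [w|e' s' c'] //= h; rewrite last_cat. Qed.

Lemma pcatA p q r (pq : ptarget p = psource q) (qr : ptarget q = psource r)
    (pq_r : ptarget (pcat pq) = psource r)
    (p_qr : ptarget p = psource (pcat qr)) :
  pcat pq_r = pcat p_qr.
Proof.
case: p q r pq qr pq_r p_qr => [u|e s c] [v|e' s' c'] [w|e'' s'' c''] //=;
  by move=> *; apply: EPath_eq; rewrite -?catA.
Qed.

HB.instance Definition _ := gen_eqMixin finite_path.
HB.instance Definition _ := gen_choiceMixin finite_path.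

End FinitePaths.

Arguments VPath {E} v.

(* The vertex set E^0 is regarded as a subset of the set of finite paths through
   [VPath]; thus [VPath (psource p)] is the image of p under s_PE. *)
Record path_hom (E F : graph) := PathHom {
  path_fun :> finite_path E -> finite_path F;
  path_fun_vertex : forall v, exists w, path_fun (VPath v) = VPath w;
  path_fun_source : forall p,
    VPath (psource (path_fun p)) = path_fun (VPath (psource p));
  path_fun_target : forall p,
    VPath (ptarget (path_fun p)) = path_fun (VPath (ptarget p));
  path_fun_cat : forall p q (pq : ptarget p = psource q)
    (fpq : ptarget (path_fun p) = psource (path_fun q)),
    path_fun (pcat pq) = pcat fpq }.

(* The map E^0 -> F^0 to which f restricts, see [VPath_vertex_map]. *)
Definition vertex_map (E F : graph) (f : path_hom E F) (v : vertex E) :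
  vertex F := psource (f (VPath v)).

Lemma VPath_vertex_map E F (f : path_hom E F) v :
  VPath (vertex_map f v) = f (VPath v).
Proof. exact: path_fun_source. Qed.

Lemma path_hom_eq E F (f g : path_hom E F) : f =1 g -> f = g.
Proof.
move=> /funext; case: f g => [f fv fs ft fc] [g gv gs gt gc] /= fg.
by subst g; congr PathHom; exact: Prop_irrelevance.
Qed.

Definition path_hom_id (E : graph) : path_hom E E.
Proof.
apply: (@PathHom E E id) => // [v|p q pq fpq]; first by exists v.
by rewrite (Prop_irrelevance pq fpq).
Defined.

Definition path_hom_comp (E F G : graph) (g : path_hom F G) (f : path_hom E F) :
  path_hom E G.
Proof.
apply: (@PathHom E G (g \o f)) => /= [v|p|p|p q pq gfpq].
- by exists (vertex_map g (vertex_map f v)); rewrite !VPath_vertex_map.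
- by rewrite path_fun_source path_fun_source.
- by rewrite path_fun_target path_fun_target.
- have fpq : ptarget (f p) = psource (f q).
    suff: VPath (ptarget (f p)) = VPath (psource (f q)) by case.
    by rewrite path_fun_target path_fun_source pq.
  by rewrite (path_fun_cat pq fpq) (path_fun_cat fpq gfpq).
Defined.

Record category := Category {
  obj :> Type;
  mor : obj -> obj -> Type;
  mor_id : forall X, mor X X;
  mor_comp : forall X Y Z, mor Y Z -> mor X Y -> mor X Z;
  mor_comp1l : forall X Y (f : mor X Y), mor_comp (mor_id Y) f = f;
  mor_comp1r : forall X Y (f : mor X Y), mor_comp f (mor_id X) = f;
  mor_compA : forall X Y Z W (h : mor Z W) (g : mor Y Z) (f : mor X Y),
    mor_comp h (mor_comp g f) = mor_comp (mor_comp h g) f }.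

Record is_functor (C D : category) (F0 : C -> D)
    (F1 : forall X Y, mor X Y -> mor (F0 X) (F0 Y)) : Prop := IsFunctor {
  functor_id : forall X, F1 X X (mor_id X) = mor_id (F0 X);
  functor_comp : forall X Y Z (g : mor Y Z) (f : mor X Y),
    F1 X Z (mor_comp g f) = mor_comp (F1 Y Z g) (F1 X Y f) }.

Record ipg_hom (E F : graph) := IpgHom {
  ipg_path_hom :> path_hom E F;
  ipg_inj : injective (vertex_map ipg_path_hom) }.

Lemma ipg_hom_eq E F (f g : ipg_hom E F) : f =1 g -> f = g.
Proof.
case: f g => [f fi] [g gi] /= /path_hom_eq fg; subst g.
by rewrite (Prop_irrelevance fi gi).
Qed.

Lemma vertex_map_comp E F G (g : path_hom F G) (f : path_hom E F) :
  vertex_map (path_hom_comp g f) =1 vertex_map g \o vertex_map f.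
Proof. by move=> v; rewrite /vertex_map /= -VPath_vertex_map. Qed.

Definition ipg_id E : ipg_hom E E.
Proof. by exists (path_hom_id E) => v w. Defined.

Definition ipg_comp E F G (g : ipg_hom F G) (f : ipg_hom E F) : ipg_hom E G.
Proof.
exists (path_hom_comp g f).
exact: eq_inj (inj_comp (@ipg_inj _ _ g) (@ipg_inj _ _ f))
  (fsym (vertex_map_comp g f)).
Defined.

Definition IPG : category.
Proof.
by apply: (@Category graph ipg_hom ipg_id ipg_comp) => *; exact: ipg_hom_eq.
Defined.

Record bpg_obj := BpgObj {
  bpg_graph :> graph;
  bpg_finite : finite_set [set: vertex bpg_graph] }.

Record bpg_hom (E F : bpg_obj) := BpgHom {
  bpg_path_hom :> path_hom E F;
  bpg_bij : bijective (vertex_map bpg_path_hom) }.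

Lemma bpg_hom_eq E F (f g : bpg_hom E F) : f =1 g -> f = g.
Proof.
case: f g => [f fb] [g gb] /= /path_hom_eq fg; subst g.
by rewrite (Prop_irrelevance fb gb).
Qed.

Definition bpg_id E : bpg_hom E E.
Proof. by exists (path_hom_id E); exists id. Defined.

Definition bpg_comp E F G (g : bpg_hom F G) (f : bpg_hom E F) : bpg_hom E G.
Proof.
exists (path_hom_comp g f).
exact: eq_bij (bij_comp (bpg_bij g) (bpg_bij f)) _ (fsym (vertex_map_comp g f)).
Defined.

Definition BPG : category.
Proof.
by apply: (@Category bpg_obj bpg_hom bpg_id bpg_comp) => *; exact: bpg_hom_eq.
Defined.

(* The inclusion of BPG into IPG; on objects it is [bpg_graph]. *)
Definition bpg_ipg (E F : bpg_obj) (f : bpg_hom E F) : ipg_hom E F :=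
  IpgHom (bij_inj (bpg_bij f)).

(* Associative, not necessarily unital. The [algType] of MathComp is not
   suitable: it is unital and nonzero. *)
Record algebra (k : fieldType) := Algebra {
  algebra_sort :> lmodType k;
  amul : algebra_sort -> algebra_sort -> algebra_sort;
  amulA : associative amul;
  amulDl : left_distributive amul +%R;
  amulDr : right_distributive amul +%R;
  ascaleAl : forall a x y, a *: amul x y = amul (a *: x) y;
  ascaleAr : forall a x y, a *: amul x y = amul x (a *: y) }.

(* The zero algebra has a unit. *)
Record unit_of (k : fieldType) (A : algebra k) := UnitOf {
  aone : A;
  amul1l : left_id aone (@amul k A);
  amul1r : right_id aone (@amul k A) }.

Record unital_algebra (k : fieldType) := UnitalAlgebra {
  unital_base :> algebra k;
  unital_unit : unit_of unital_base }.

Section AlgebraCategories.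
Variable k : fieldType.

Record alg_hom (A B : algebra k) := AlgHom {
  alg_fun :> A -> B;
  alg_fun_linear : linear alg_fun;
  alg_fun_mul : {morph alg_fun : x y / amul x y >-> amul x y} }.

Lemma alg_hom_eq A B (f g : alg_hom A B) : f =1 g -> f = g.
Proof.
move=> /funext; case: f g => [f fl fm] [g gl gm] /= fg.
by subst g; congr AlgHom; exact: Prop_irrelevance.
Qed.

Definition alg_id A : alg_hom A A.
Proof. by exists id. Defined.

Definition alg_comp A B C (g : alg_hom B C) (f : alg_hom A B) : alg_hom A C.
Proof.
exists (g \o f) => [a x y|x y] /=; first by rewrite !alg_fun_linear.
by rewrite !alg_fun_mul.
Defined.

Definition KA : category.
Proof.
by apply: (@Category (algebra k) alg_hom alg_id alg_comp) => *;
  exact: alg_hom_eq.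
Defined.

Record ualg_hom (A B : unital_algebra k) := UalgHom {
  ualg_alg_hom :> alg_hom A B;
  ualg_fun1 : ualg_alg_hom (aone (unital_unit A)) = aone (unital_unit B) }.

Lemma ualg_hom_eq A B (f g : ualg_hom A B) : f =1 g -> f = g.
Proof.
case: f g => [f f1] [g g1] /= /alg_hom_eq fg; subst g.
by rewrite (Prop_irrelevance f1 g1).
Qed.

Definition ualg_id A : ualg_hom A A.
Proof. by exists (alg_id A). Defined.

Definition ualg_comp A B C (g : ualg_hom B C) (f : ualg_hom A B) :
  ualg_hom A C.
Proof. by exists (alg_comp g f); rewrite /= !ualg_fun1. Defined.

Definition UKA : category.
Proof.
by apply: (@Category (unital_algebra k) ualg_hom ualg_id ualg_comp) => *;
  exact: ualg_hom_eq.
Defined.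

End AlgebraCategories.

Section PathAlgebra.
Variables (k : fieldType) (E : graph).

(* Finitely supported functions from paths to k, i.e. the vector space with
   basis the family [pchi]. *)
Local Notation V := {malg k[finite_path E]}.

Definition pchi (p : finite_path E) : V := << p >>.

Definition pchi_mul (p q : finite_path E) : V :=
  if pselect (ptarget p = psource q) is left pq then pchi (pcat pq) else 0.

(* The bilinear extension of [pchi_mul]. *)
Definition pmul (x y : V) : V :=
  \sum_(p <- msupp x) \sum_(q <- msupp y) (x@_p * y@_q) *: pchi_mul p q.

Lemma pmulEw (d1 d2 : {fset finite_path E}) x y :
    (msupp x `<=` d1)%fset -> (msupp y `<=` d2)%fset ->
  pmul x y = \sum_(p <- d1) \sum_(q <- d2) (x@_p * y@_q) *: pchi_mul p q.
Proof.
move=> s1 s2; rewrite /pmul (big_fset_incl _ s1) /=; last first.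
  move=> p _ /mcoeff_outdom xp; rewrite big1_fset// => q _ _.
  by rewrite xp mul0r scale0r.
apply: eq_bigr => p _; rewrite (big_fset_incl _ s2) //= => q _.
by move=> /mcoeff_outdom yq; rewrite yq mulr0 scale0r.
Qed.

Lemma pmul_linearl y : linear (pmul^~ y).
Proof.
move=> a x x'; pose d := (msupp x `|` msupp x' `|` msupp (a *: x + x'))%fset.
have yy := fsubset_refl (msupp y).
have le0 : (msupp (a *: x + x') `<=` d)%fset by rewrite fsubsetUr.
have le1 : (msupp x `<=` d)%fset by rewrite /d -fsetUA fsubsetUl.
have le2 : (msupp x' `<=` d)%fset by rewrite /d fsetUAC fsubsetUr.
rewrite (pmulEw le0 yy) (pmulEw le1 yy) (pmulEw le2 yy).
rewrite scaler_sumr -big_split; apply: eq_bigr => p _ /=.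
rewrite scaler_sumr -big_split; apply: eq_bigr => q _ /=.
by rewrite mcoeffD mcoeffZ mulrDl scalerDl scalerA mulrA.
Qed.

Lemma pmul_linearr x : linear (pmul x).
Proof.
move=> a y y'; pose d := (msupp y `|` msupp y' `|` msupp (a *: y + y'))%fset.
have xx := fsubset_refl (msupp x).
have le0 : (msupp (a *: y + y') `<=` d)%fset by rewrite fsubsetUr.
have le1 : (msupp y `<=` d)%fset by rewrite /d -fsetUA fsubsetUl.
have le2 : (msupp y' `<=` d)%fset by rewrite /d fsetUAC fsubsetUr.
rewrite (pmulEw xx le0) (pmulEw xx le1) (pmulEw xx le2).
rewrite scaler_sumr -big_split; apply: eq_bigr => p _ /=.
rewrite scaler_sumr -big_split; apply: eq_bigr => q _ /=.
by rewrite mcoeffD mcoeffZ mulrDr scalerDl scalerA mulrCA.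
Qed.

Lemma pmul_chi p q : pmul (pchi p) (pchi q) = pchi_mul p q.
Proof.
rewrite (pmulEw (@msuppU_le _ _ _ _) (@msuppU_le _ _ _ _)).
by rewrite !big_seq_fset1 !mcoeffUU mulr1 scale1r.
Qed.

Lemma pchi_sum x : x = \sum_(p <- msupp x) x@_p *: pchi p.
Proof.
rewrite {1}(monalgE x); apply: eq_bigr => p _.
by apply/malgP => q; rewrite mcoeffZ !mcoeffU mulr_natr.
Qed.

Lemma pchi_linear_ext (W : lmodType k) (f g : V -> W) :
  linear f -> linear g -> (forall p, f (pchi p) = g (pchi p)) -> f =1 g.
Proof.
move=> lf lg fg x.
pose f' : {linear V -> W} := HB.pack f (GRing.isLinear.Build _ _ _ _ f lf).
pose g' : {linear V -> W} := HB.pack g (GRing.isLinear.Build _ _ _ _ g lg).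
rewrite -[f]/(f' : V -> W) -[g]/(g' : V -> W) (pchi_sum x) !linear_sum.
by apply: eq_bigr => p _; rewrite !linearZ /= fg.
Qed.

Lemma pmulx0 x : pmul x 0 = 0.
Proof.
by move: (pmul_linearr x (-1) 0 0); rewrite scaler0 addr0 scaleN1r addNr.
Qed.

Lemma pmul0x x : pmul 0 x = 0.
Proof.
by move: (pmul_linearl x (-1) 0 0); rewrite scaler0 addr0 scaleN1r addNr.
Qed.

Lemma pmulA : associative pmul.
Proof.
have lC (f g : V -> V) : linear f -> linear g -> linear (f \o g).
  by move=> lf lg a x y /=; rewrite lg lf.
move=> x y z; move: x.
apply: (@pchi_linear_ext V (pmul^~ (pmul y z)) (pmul^~ z \o pmul^~ y)).
- exact: pmul_linearl.
- by apply: lC; exact: pmul_linearl.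
move=> p /=; move: y.
apply: (@pchi_linear_ext V (pmul (pchi p) \o pmul^~ z)
  (pmul^~ z \o pmul (pchi p))).
- by apply: lC; [exact: pmul_linearr|exact: pmul_linearl].
- by apply: lC; [exact: pmul_linearl|exact: pmul_linearr].
move=> q /=; move: z.
apply: (@pchi_linear_ext V (pmul (pchi p) \o pmul (pchi q))
  (pmul (pmul (pchi p) (pchi q)))).
- by apply: lC; exact: pmul_linearr.
- exact: pmul_linearr.
move=> r /=; rewrite !pmul_chi /pchi_mul.
case: pselect => [qr|nqr]; case: pselect => [pq|npq] //=;
  rewrite ?pmulx0 ?pmul0x ?pmul_chi /pchi_mul //.
- case: pselect => [p_qr|] /=; last by rewrite psource_cat.
  case: pselect => [pq_r|] /=; last by rewrite ptarget_cat.
  by rewrite (pcatA pq_r p_qr).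
- by case: pselect => // p_qr; case: npq; rewrite p_qr psource_cat.
- by case: pselect => // pq_r; case: nqr; rewrite -pq_r ptarget_cat.
Qed.

Definition path_algebra : algebra k.
Proof.
apply: (@Algebra k V pmul) => [|x y z|x y z|a x y|a x y].
- exact: pmulA.
- by rewrite -[x in LHS]scale1r pmul_linearl scale1r.
- by rewrite -[y in LHS]scale1r pmul_linearr scale1r.
- by rewrite -[a *: x in RHS]addr0 pmul_linearl pmul0x addr0.
- by rewrite -[a *: y in RHS]addr0 pmul_linearr pmulx0 addr0.
Defined.

End PathAlgebra.

(* Main.v *)
Require Import Defs.
From HB Require Import structures.
From mathcomp Require Import all_boot all_algebra finmap.
From mathcomp Require Import boolp classical_sets cardinality.
From mathcomp.multinomials Require Import monalg.

(** The linear map [f_*] exists and is unique because the [pchi k p] form a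
basis of the path algebra; for the same reason every identity between linear
maps out of a path algebra, in particular functoriality, need only be checked
on basis vectors ([pchi_linear_ext]).

Multiplicativity of [f_*] is where injectivity on vertices enters. If [p] and
[q] are composable, so are [f p] and [f q], and both products are the basis
vector of [f (pq) = f(p) f(q)]. If they are not, [f p] and [f q] must not be
composable either: their meeting vertices are the images of the distinct
vertices [ptarget p] and [psource q], and it is injectivity that keeps these
images distinct ([composable_path_hom], [push_mul]).

When the vertex set is finite, the unit of the path algebra is the sum of all
the trivial paths: in a product with the basis vector of [p], only the trivial
path at the source (or target) of [p] survives. A path homomorphism that is
bijective on vertices permutes the terms of this sum, so it maps unit to unit
([push_one]). *)

Set Implicit Arguments.
Unset Strict Implicit.
Unset Printing Implicit Defensive.

Import GRing.Theory.

Local Open Scope ring_scope.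

(** The maps handled below are plain functions with a proof of linearity rather
than bundled linear maps. *)
Lemma linear_fun_sum (k : fieldType) (V W : lmodType k) (h : V -> W)
    (I : Type) (r : seq I) (F : I -> V) :
  linear h -> h (\sum_(i <- r) F i) = \sum_(i <- r) h (F i).
Proof.
move=> lh.
pose h' : {linear V -> W} := HB.pack h (GRing.isLinear.Build _ _ _ _ h lh).
exact: (linear_sum h').
Qed.

Section Pushforward.
Variables (k : fieldType) (E F : graph).
Implicit Types (f : finite_path E -> finite_path F).

Local Notation kE := {malg k[finite_path E]}.
Local Notation kF := {malg k[finite_path F]}.

Definition push f (x : kE) : kF :=
  \sum_(p <- msupp x) x@_p *: pchi k (f p).

(** Enlarging the range of summation beyond the support lets sums attached to
different elements be compared term by term. *)
Lemma pushEw f (d : {fset finite_path E}) (x : kE) :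
  (msupp x `<=` d)%fset -> push f x = \sum_(p <- d) x@_p *: pchi k (f p).
Proof.
move=> xd; rewrite /push (big_fset_incl _ xd) //= => p _ /mcoeff_outdom ->.
by rewrite scale0r.
Qed.

Lemma push_linear f : linear (push f).
Proof.
move=> a x y; pose d := (msupp x `|` msupp y `|` msupp (a *: x + y))%fset.
have sxy : (msupp (a *: x + y) `<=` d)%fset by rewrite fsubsetUr.
have sx : (msupp x `<=` d)%fset by rewrite /d -fsetUA fsubsetUl.
have sy : (msupp y `<=` d)%fset by rewrite /d fsetUAC fsubsetUr.
rewrite (pushEw _ sxy) (pushEw _ sx) (pushEw _ sy) scaler_sumr -big_split.
by apply: eq_bigr => p _ /=; rewrite mcoeffD mcoeffZ scalerDl scalerA.
Qed.

Lemma push_chi f p : push f (pchi k p) = pchi k (f p).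
Proof.
rewrite (pushEw _ (@msuppU_le _ _ _ _)).
by rewrite big_seq_fset1 mcoeffUU scale1r.
Qed.

Lemma push0 f : push f 0 = 0.
Proof. by rewrite /push msupp0 big_seq_fset0. Qed.

End Pushforward.

(** Path homomorphisms preserve composability in any case; injectivity is what
makes them reflect it, so that vanishing products stay zero in [push_mul]. *)
Lemma composable_path_hom E F (f : path_hom E F) p q :
    injective (vertex_map f) ->
  (ptarget (f p) = psource (f q)) <-> (ptarget p = psource q).
Proof.
move=> f_inj; split=> [|pq].
  move=> /(congr1 VPath); rewrite path_fun_target path_fun_source.
  by rewrite -!VPath_vertex_map => -[/f_inj].
suff: VPath (ptarget (f p)) = VPath (psource (f q)) by case.
by rewrite path_fun_target path_fun_source pq.
Qed.

Lemma push_chi_mul (k : fieldType) E F (f : path_hom E F) p q :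
    injective (vertex_map f) ->
  push f (pchi_mul k p q) = pchi_mul k (f p) (f q).
Proof.
move=> f_inj; have fE := composable_path_hom p q f_inj; rewrite /pchi_mul.
case: pselect => [pq|npq] /=; case: pselect => [fpq|nfpq] /=.
- by rewrite push_chi (path_fun_cat pq fpq).
- by case: nfpq; exact/fE.
- by case: npq; exact/fE.
- by rewrite push0.
Qed.

(** Both sides are bilinear, so the identity is extended from basis vectors
one variable at a time. *)
Lemma push_mul (k : fieldType) E F (f : path_hom E F) :
    injective (vertex_map f) ->
  {morph push (k:=k) f : x y / pmul x y >-> pmul x y}.
Proof.
move=> f_inj x y; pose fk := push (k:=k) f.
have fkl : linear fk := push_linear f.
suff fkM p : fk \o pmul (pchi k p) =1 pmul (fk (pchi k p)) \o fk.
  suff: fk \o (@pmul k E)^~ y =1 (@pmul k F)^~ (fk y) \o fk by exact.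
  apply: pchi_linear_ext => [a x1 x2|a x1 x2|p] /=; last exact: fkM.
  - by rewrite pmul_linearl fkl.
  - by rewrite fkl pmul_linearl.
apply: pchi_linear_ext => [a y1 y2|a y1 y2|q] /=.
- by rewrite pmul_linearr fkl.
- by rewrite fkl pmul_linearr.
- by rewrite /fk !push_chi !pmul_chi push_chi_mul.
Qed.

Definition push_alg (k : fieldType) (E F : IPG) (f : mor E F) :
  @mor (KA k) (path_algebra k E) (path_algebra k F) :=
  @AlgHom k (path_algebra k E) (path_algebra k F)
    (push f) (push_linear f) (push_mul (@ipg_inj E F f)).

Lemma push_alg_functor (k : fieldType) :
  @is_functor IPG (KA k) (path_algebra k) (@push_alg k).
Proof.
split=> [E|E F G g f]; apply: alg_hom_eq => /=.
- apply: pchi_linear_ext; [exact: push_linear|by []|exact: push_chi].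
- apply: (@pchi_linear_ext k E _ _ (push g \o push f)).
  + exact: push_linear.
  + by move=> a x y /=; rewrite !push_linear.
  + by move=> p /=; rewrite !push_chi.
Qed.

Section Unit.
Variable k : fieldType.

Definition trivial_paths (E : bpg_obj) : {fset finite_path E} :=
  fset_set (range (@VPath E)).

(** The finite set [trivial_paths] replaces a sum over the vertices, which form
a bare type without a canonical enumeration. *)
Definition path_one (E : bpg_obj) : {malg k[finite_path E]} :=
  \sum_(e <- trivial_paths E) pchi k e.

Lemma finite_range_VPath (E : bpg_obj) : finite_set (range (@VPath E)).
Proof. exact/finite_image/bpg_finite. Qed.

Lemma mem_trivial_paths (E : bpg_obj) (v : vertex E) :
  VPath v \in trivial_paths E.
Proof.
by rewrite in_fset_set; [rewrite inE; exists v|exact: finite_range_VPath].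
Qed.

Lemma trivial_pathsP (E : bpg_obj) (e : finite_path E) :
  e \in trivial_paths E -> exists v, e = VPath v.
Proof.
rewrite in_fset_set; last exact: finite_range_VPath.
by rewrite inE => -[v _ <-]; exists v.
Qed.

Lemma path_one_mul (E : bpg_obj) : left_id (path_one E) (@pmul k E).
Proof.
apply: pchi_linear_ext; [exact: pmul_linearr|by []|move=> p].
rewrite (linear_fun_sum _ _ (pmul_linearl (pchi k p))).
rewrite (big_fsetD1 _ (mem_trivial_paths (psource p))) /=.
rewrite pmul_chi /pchi_mul; case: pselect => //= sp.
rewrite big1_fset ?addr0 // => e /fsetD1P[ne /trivial_pathsP[v ev]] _.
rewrite pmul_chi /pchi_mul; case: pselect => //= ep.
by case/eqP: ne; rewrite ev -ep ev.
Qed.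

Lemma path_mul_one (E : bpg_obj) : right_id (path_one E) (@pmul k E).
Proof.
apply: (@pchi_linear_ext k E _ ((@pmul k E)^~ (path_one E)));
  [exact: pmul_linearl|by []|move=> p].
rewrite (linear_fun_sum _ _ (pmul_linearr (pchi k p))).
rewrite (big_fsetD1 _ (mem_trivial_paths (ptarget p))) /=.
rewrite pmul_chi /pchi_mul; case: pselect => //= tp.
rewrite big1_fset ?addr0 => [|e /fsetD1P[ne /trivial_pathsP[v ev]] _].
  by congr pchi; case: p tp.
rewrite pmul_chi /pchi_mul; case: pselect => //= pe.
by case/eqP: ne; rewrite pe ev.
Qed.

Definition path_unit (E : bpg_obj) : unit_of (path_algebra k E) :=
  @UnitOf k (path_algebra k E) (path_one E)
    (@path_one_mul E) (@path_mul_one E).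

(** The inclusion from left to right is surjectivity on vertices. *)
Lemma trivial_paths_image (E F : bpg_obj) (f : bpg_hom E F) :
  trivial_paths F = [fset f e | e in trivial_paths E]%fset.
Proof.
have [g _ fK] := bpg_bij f.
apply/fsetP => e; apply/idP/imfsetP => [/trivial_pathsP[w ->]|[e' /= e'E ->]].
  exists (VPath (g w)); first exact: mem_trivial_paths.
  by rewrite -VPath_vertex_map fK.
have [v ->] := trivial_pathsP e'E.
by rewrite -VPath_vertex_map mem_trivial_paths.
Qed.

(** The trivial paths of [F] are those of [E] relabelled by [f]. Surjectivity on
vertices ensures that none is missed, injectivity that none is repeated. *)
Lemma push_one (E F : bpg_obj) (f : bpg_hom E F) :
  push f (path_one E) = path_one F.
Proof.
rewrite (linear_fun_sum _ _ (push_linear f)) /path_one.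
rewrite (trivial_paths_image f) big_imfset /=.
  by apply: eq_bigr => e _; rewrite push_chi.
move=> _ _ /trivial_pathsP[v ->] /trivial_pathsP[w ->].
by rewrite -!VPath_vertex_map => -[/(bij_inj (bpg_bij f)) ->].
Qed.

Definition push_ualg (E F : BPG) (f : mor E F) :
  @mor (UKA k) (UnitalAlgebra (path_unit E)) (UnitalAlgebra (path_unit F)) :=
  @UalgHom k (UnitalAlgebra (path_unit E)) (UnitalAlgebra (path_unit F))
    (push_alg k (bpg_ipg f)) (push_one f).

Lemma push_ualg_functor :
  @is_functor BPG (UKA k) (fun E => UnitalAlgebra (path_unit E)) push_ualg.
Proof.
have ev (A B : algebra k) (h h' : alg_hom A B) : h = h' -> h =1 h'.
  by move=> ->.
split=> [E|E F G g f]; apply: ualg_hom_eq.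
- exact: ev (functor_id (push_alg_functor k) (bpg_graph E)).
- exact: ev (functor_comp (push_alg_functor k) (bpg_ipg g) (bpg_ipg f)).
Qed.

End Unit.

Theorem proposition4p1 (k : fieldType) :
  exists F1 : forall E F : IPG,
      mor E F -> @mor (KA k) (path_algebra k E) (path_algebra k F),
    [/\ forall (E F : IPG) (f : mor E F) (p : finite_path E),
          F1 E F f (pchi k p) = pchi k (f p),
        forall (E F : IPG) (f : mor E F)
            (g : {linear path_algebra k E -> path_algebra k F}),
          (forall p : finite_path E, g (pchi k p) = pchi k (f p)) ->
          g =1 F1 E F f,
        @is_functor IPG (KA k) (path_algebra k) F1
      & exists (u : forall E : BPG, unit_of (path_algebra k (bpg_graph E)))
            (G1 : forall E F : BPG, mor E F ->
               @mor (UKA k) (UnitalAlgebra (u E)) (UnitalAlgebra (u F))),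
          (forall (E F : BPG) (f : mor E F),
             ualg_alg_hom (G1 E F f) = F1 _ _ (bpg_ipg f)) /\
          @is_functor BPG (UKA k) (fun E => UnitalAlgebra (u E)) G1].
Proof.
exists (@push_alg k); split.
- by move=> E F f p; exact: push_chi.
- move=> E F f g gE; apply: pchi_linear_ext.
  + exact: linearP.
  + exact: push_linear.
  + by move=> p; rewrite gE [RHS]push_chi.
- exact: push_alg_functor.
- exists (@path_unit k), (@push_ualg k); split=> //.
  exact: push_ualg_functor.
Qed.
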